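(* Let $(\alpha_j,\beta_j)$ be a single band and let $N^{(n,j)}$ be the number of zeros of $P_n$ in $(\alpha_j,\beta_j)$. Then for all integers $m\ge0$ and $-1\le b\le p-1$ with $mp+b\ge0$, $$\bigl|N^{(mp+b,j)}-(m-1)\bigr|\le\min(b+1,\,p-b).$$ In particular, for all $n\ge 0$, $$\Bigl|N^{(n,j)}-\frac np\Bigr|\le 1+\frac p2 .$$
   Context: Let $p\ge 1$ and let $\{a_n\}_{n\ge1}$, $\{b_n\}_{n\ge1}$ be real sequences with $a_n>0$, $a_{n+p}=a_n$, $b_{n+p}=b_n$. The orthonormal polynomials $p_n$ are defined by $p_{-1}\equiv0$, $p_0\equiv1$, $xp_n(x)=a_{n+1}p_{n+1}(x)+b_{n+1}p_n(x)+a_np_{n-1}(x)$ for $n\ge0$ (with $a_0:=a_p$); $P_n$ is the monic multiple of $p_n$ (same zeros). Let $A_k(z)=\frac1{a_{k+1}}\begin{pmatrix} z-b_{k+1}&-a_k\\ a_{k+1}&0\end{pmatrix}$, $T_n(z)=A_{n-1}(z)\cdots A_0(z)$, and $\Delta(z)=\mathrm{Tr}(T_p(z))$. The polynomial $\Delta$ has degree $p$, and $\{z\in\mathbb C:\Delta(z)\in(-2,2)\}$ is a union of $p$ disjoint open real intervals $(\alpha_j,\beta_j)$, with $\alpha_1<\beta_1\le\alpha_2<\beta_2\le\cdots\le\alpha_p<\beta_p$. These intervals are the (open) bands. *)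

(* Defs.v *)
From HB Require Import structures.
From mathcomp Require Import all_boot all_order all_algebra.
From mathcomp Require Import reals.
From mathcomp Require Import complex polyrcf.

Set Implicit Arguments.
Unset Strict Implicit.
Unset Printing Implicit Defensive.

Import Order.TTheory GRing.Theory Num.Theory.
Local Open Scope ring_scope.

(* The Jacobi sequences are a, b : nat -> R; only the entries of index >= 1
   are ever used. *)
Definition periodic_jacobi (R : realType) (p : nat) (a b : nat -> R) : Prop :=
  [/\ forall n, (1 <= n)%N -> 0 < a n,
      forall n, (1 <= n)%N -> a (n + p)%N = a n
    & forall n, (1 <= n)%N -> b (n + p)%N = b n].

(* The inner match is a_k p_(k-1), which vanishes for k = 0 since p_(-1) = 0. *)
Fixpoint orthopoly (R : realType) (a b : nat -> R) (n : nat) : {poly R} :=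
  match n with
  | 0%N => 1
  | k.+1 =>
      (a k.+1)^-1 *: (('X - (b k.+1)%:P) * orthopoly a b k
        - match k with 0%N => 0 | l.+1 => a k *: orthopoly a b l end)
  end.

Lemma orthopoly_rec0 (R : realType) (a b : nat -> R) : a 1%N != 0 ->
  'X * orthopoly a b 0 = a 1%N *: orthopoly a b 1 + b 1%N *: orthopoly a b 0.
Proof.
by move=> a0; rewrite /= scalerA divff// scale1r subr0 !mulr1 alg_polyC subrK.
Qed.

Lemma orthopoly_recS (R : realType) (a b : nat -> R) (n : nat) :
  a n.+2 != 0 ->
  'X * orthopoly a b n.+1 = a n.+2 *: orthopoly a b n.+2
    + b n.+2 *: orthopoly a b n.+1 + a n.+1 *: orthopoly a b n.
Proof.
move=> a0.
have -> : orthopoly a b n.+2 = (a n.+2)^-1 *: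
  (('X - (b n.+2)%:P) * orthopoly a b n.+1 - a n.+1 *: orthopoly a b n) by [].
rewrite scalerA divff// scale1r -(mul_polyC (b n.+2)) mulrBl.
by rewrite addrAC subrK subrK.
Qed.

Definition monic_orthopoly (R : realType) (a b : nat -> R) (n : nat) : {poly R} :=
  (lead_coef (orthopoly a b n))^-1 *: orthopoly a b n.

(* a extended to index 0 by the convention a_0 = a_p. *)
Definition acoef (R : realType) (p : nat) (a : nat -> R) (k : nat) : R :=
  if k == 0%N then a p else a k.

(* Transfer matrices, with polynomial entries in the spectral variable z = 'X. *)
Definition step_matrix (R : realType) (p : nat) (a b : nat -> R) (k : nat) :
    'M[{poly R}]_2 :=
  ((a k.+1)^-1)%:P *:
    \matrix_(i < 2, j < 2)
      nth 0 (nth [::] [:: [:: 'X - (b k.+1)%:P; - (acoef p a k)%:P];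
                          [:: (a k.+1)%:P;       0               ]] i) j.

Fixpoint transfer_matrix (R : realType) (p : nat) (a b : nat -> R) (n : nat) :
    'M[{poly R}]_2 :=
  if n is k.+1 then step_matrix p a b k *m transfer_matrix p a b k else 1%:M.

Definition discriminant (R : realType) (p : nat) (a b : nat -> R) : {poly R} :=
  \tr (transfer_matrix p a b p).

Definition discriminant_at (R : realType) (p : nat) (a b : nat -> R) (z : R[i]) :
    R[i] :=
  (map_poly (real_complex R) (discriminant p a b)).[z].

(* The order on R[i] is the partial one: -2 < w < 2 says that w is real and
   lies in (-2, 2).  Bands are indexed from 0 here. *)
Definition band_edges (R : realType) (p : nat) (a b : nat -> R)
    (alpha beta : 'I_p -> R) : Prop :=
  [/\ forall j : 'I_p, alpha j < beta j,
      forall i j : 'I_p, (i < j)%N -> beta i <= alpha j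
    & forall z : R[i], -2 < discriminant_at p a b z < 2 <->
        exists (j : 'I_p) (x : R), alpha j < x < beta j /\ z = real_complex R x].

(* roots P x y lists, without repetition, the roots of P in the open interval
   ]x, y[; the zeros of an orthogonal polynomial are simple. *)
Definition zeros_in (R : realType) (P : {poly R}) (x y : R) : nat :=
  size (roots P x y).

(* Main.v *)
Require Import Defs.
From HB Require Import structures.
From mathcomp Require Import all_boot all_order all_algebra.
From mathcomp Require Import reals trigo.
From mathcomp Require Import complex polyrcf.
From mathcomp Require Import ring lra zify.

Import Order.TTheory GRing.Theory Num.Theory.
Local Open Scope ring_scope.

(** Write Delta for the discriminant and N(n) for the number of zeros of p_n
in the band.  Two facts carry the proof.

The degrees n = (m+1)p - 1 are exactly solvable: there N(n) = m.  Let T be the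
transfer matrix over one period.  It has determinant 1, so Cayley-Hamilton
reads T^2 = Delta T - 1, and the lower left entry of T^m, which is p_(mp-1),
obeys a Chebyshev recursion in Delta: p_(mp-1) = p_(p-1) S_m(Delta)
([orthopoly_period]), where S_m(2 cos t) = sin(m t) / sin t has m - 1 simple
zeros, all in (-2, 2).  At a zero of p_(p-1) the matrix T is triangular with
diagonal entries A and 1/A, so |Delta| = |A + 1/A| >= 2 and the factor p_(p-1)
has no zero in a band ([discriminant_orthopoly_root]).  Finally Delta maps each
band bijectively onto (-2, 2) ([discriminant_inj], [discriminant_surj]), so
S_(m+1)(Delta) has exactly m zeros there.

The bijectivity is where it matters that the bands describe the complex
preimage of (-2, 2): for t in (-2, 2) all the roots of Delta - t are real, so
the strict Laguerre inequality f f'' < f'^2 holds for f = Delta - t wherever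
f does not vanish.  At a critical point of Delta inside a band, a value t just
above and a value t just below Delta would force opposite signs of Delta''.
Hence Delta' has no zero in a band, Delta is injective there by Rolle, and it is
onto by the intermediate value theorem.

In between, N(n) and N(n+1) differ by at most 1, because zeros of p_n and
p_(n+1) interlace: the Wronskian p_(n+1)' p_n - p_(n+1) p_n' is positive
everywhere ([orthopoly_wronskian], [size_roots_interlace]).

For n = mp + c with 0 <= c < p, comparing with the exact values at mp - 1 and
(m+1)p - 1 gives |N(n) - (m-1)| <= c + 1 and |N(n) - m| <= p - 1 - c, which
contains the first claim.  The triangle inequality applied to the first claim
is too weak for the second one; its lower bound uses
N(n) >= m - min(c + 2, p - 1 - c), which is sharper. *)

(** * Interlacing from a positive Wronskian *)

(** Morally, f / g is increasing between consecutive poles, so it cannot vanish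
twice there.  To stay with polynomials: write f = s (X - y) (X - x).  The sign
condition at x and y makes f' g positive at both points, so g s changes sign
between them.  If g does not, then s has a root z in ]x, y[, which is another
root of f, and the argument restarts on ]x, z[, which contains fewer roots. *)
Lemma root_between (R : rcfType) (f g : {poly R}) :
    (forall x, 0 < f^`().[x] * g.[x] - f.[x] * g^`().[x]) ->
  forall x y, x < y -> root f x -> root f y ->
  exists2 w, root g w & x < w < y.
Proof.
move=> W x y; move: {2}(size (roots f x y)).+1 (ltnSn (size (roots f x y))) => n.
elim: n y => // n IHn y; rewrite ltnS => szn lt_xy fx fy.
have Wx := W x; have Wy := W y; have /rootP fx0 := fx; have /rootP fy0 := fy.
rewrite fx0 mul0r subr0 in Wx; rewrite fy0 mul0r subr0 in Wy.
have [q fE] := factor_theorem f x fx.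
have {}/factor_theorem[s qE] : root q y.
  move: fy; rewrite fE rootM root_XsubC => /orP[//|/eqP yx].
  by move: lt_xy; rewrite yx ltxx.
have [/poly_ivtoo gxy|gxy] := ltrP (g.[x] * g.[y]) 0.
  have [w] := gxy (ltW lt_xy); rewrite in_itv => xwy gw; by exists w.
have sxy : s.[x] * s.[y] < 0.
  move: Wx Wy; rewrite fE qE !derivM !derivXsubC !hornerE /= => Wx Wy.
  have : 0 < (y - x) ^+ 2 * (g.[x] * g.[y]) * - (s.[x] * s.[y]).
    have := mulr_gt0 Wx Wy; congr (0 < _); ring.
  rewrite mulrN oppr_gt0 !ltNge; apply: contra; apply: mulr_ge0.
  by rewrite mulr_ge0 ?sqr_ge0.
have [z] := poly_ivtoo (ltW lt_xy) sxy.
rewrite in_itv /= => /andP[xz zy] sz.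
have fz : root f z by rewrite fE qE !rootM sz.
have fN0 : f != 0.
  by apply: contraTneq Wx => ->; rewrite derivC horner0 mul0r ltxx.
have [||w gw /andP[xw wz]] := IHn z _ xz _ fz; last 1 first.
- by exists w; rewrite // xw (lt_trans wz).
- (* z itself is a root of f in ]x, y[ but not in ]x, z[. *)
  apply: leq_trans szn; apply: (@uniq_leq_size _ (z :: roots f x z)).
    by rewrite /= uniq_roots andbT in_roots in_itv /= ltxx !andbF.
  move=> t; rewrite inE => /orP[/eqP->|].
    by rewrite in_roots fz in_itv /= xz zy fN0.
  rewrite !in_roots !in_itv /= => /and3P[-> /andP[-> tz] ->].
  by rewrite (lt_trans tz).
- exact/rootP.
Qed.

Lemma size_separated (R : realDomainType) (s t : seq R) :
    sorted <%R s ->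
    {in s &, forall u v, u < v -> exists2 w, w \in t & u < w < v} ->
  (size s <= (size t).+1)%N.
Proof.
elim: s t => [|u [|v s] IHs] t //= /andP[lt_uv s_sorted] sep.
have [w wt /andP[uw wv]] : exists2 w, w \in t & u < w < v.
  by apply: sep; rewrite ?inE ?eqxx ?orbT.
(* The elements of t beyond v separate the tail, and w is not among them. *)
rewrite ltnS; apply: leq_trans (IHs [seq x <- t | v < x] s_sorted _) _.
  move=> x y xs ys xy.
  have [z zt /andP[xz zy]] : exists2 z, z \in t & x < z < y.
    by apply: sep; rewrite // inE ?xs ?ys orbT.
  exists z; last by rewrite xz.
  rewrite mem_filter zt andbT; apply: le_lt_trans xz.
  move: xs; rewrite inE => /orP[/eqP->//|xs].
  exact/ltW/(allP (order_path_min lt_trans s_sorted)).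
rewrite size_filter -(count_predC [pred x | v < x] t) -addn1 leq_add2l.
by rewrite -has_count; apply/hasP; exists w; rewrite //= -leNgt ltW.
Qed.

Lemma size_roots_interlace (R : rcfType) (f g : {poly R}) (x y : R) :
    (forall z, 0 < f^`().[z] * g.[z] - f.[z] * g^`().[z]) ->
  (size (roots f x y) <= (size (roots g x y)).+1)%N.
Proof.
move=> W; apply: size_separated; first exact: sorted_roots.
move=> u v; rewrite !in_roots !in_itv /=.
move=> /and3P[fu /andP[xu uy] _] /and3P[fv /andP[xv vy] _] uv.
have [w gw /andP[uw wv]] := root_between _ _ _ W u v uv fu fv.
exists w; last by rewrite uw.
rewrite in_roots gw in_itv /= (lt_trans xu uw) (lt_trans wv vy) /=.
apply: contraTneq (W 0) => ->.
by rewrite derivC horner0 !mulr0 subrr ltxx.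
Qed.

(** * Zero counts of consecutive orthogonal polynomials *)

(** The recurrence turns the Wronskian W_n into
a_(n+2) W_(n+1) = p_(n+1)^2 + a_(n+1) W_n, and W_0 is the constant 1 / a_1. *)
Lemma orthopoly_wronskian (R : realType) (a b : nat -> R) (n : nat) (x : R) :
    (forall k, (1 <= k)%N -> 0 < a k) ->
  0 < (orthopoly a b n.+1)^`().[x] * (orthopoly a b n).[x]
      - (orthopoly a b n.+1).[x] * (orthopoly a b n)^`().[x].
Proof.
move=> a_gt0; elim: n => [|n IHn].
  rewrite /= subr0 mulr1 derivC horner0 mulr0 subr0.
  by rewrite derivZ derivXsubC !hornerE invr_gt0 a_gt0.
have aS : 0 < a n.+2 by exact: a_gt0.
have -> : orthopoly a b n.+2 = (a n.+2)^-1 *: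
  (('X - (b n.+2)%:P) * orthopoly a b n.+1 - a n.+1 *: orthopoly a b n) by [].
move: (orthopoly a b n.+1) (orthopoly a b n) IHn => p1 p0 IHn.
rewrite derivZ derivB derivM derivXsubC derivZ !hornerE.
have : 0 < (a n.+2)^-1 * (p1.[x] ^+ 2 + a n.+1 *
    (p1^`().[x] * p0.[x] - p1.[x] * p0^`().[x])).
  by rewrite mulr_gt0 ?invr_gt0 // ltr_wpDl ?sqr_ge0 // mulr_gt0 // a_gt0.
congr (0 < _); ring.
Qed.

(** The Wronskian of the zero polynomial with anything vanishes. *)
Lemma orthopoly_neq0 (R : realType) (a b : nat -> R) (n : nat) :
  (forall k, (1 <= k)%N -> 0 < a k) -> orthopoly a b n != 0.
Proof.
move=> a_gt0; apply: contraTneq (orthopoly_wronskian _ _ b n 0 a_gt0) => ->.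
by rewrite derivC horner0 !mulr0 subrr ltxx.
Qed.

Lemma zeros_in_monic (R : realType) (a b : nat -> R) (n : nat) (x y : R) :
    (forall k, (1 <= k)%N -> 0 < a k) ->
  zeros_in (monic_orthopoly a b n) x y = size (roots (orthopoly a b n) x y).
Proof.
move=> a_gt0; have pN0 := orthopoly_neq0 _ _ b n a_gt0.
have cN0 : (lead_coef (orthopoly a b n))^-1 != 0.
  by rewrite invr_eq0 lead_coef_eq0.
rewrite /zeros_in /monic_orthopoly; congr size.
apply/roots_eq; rewrite ?scaler_eq0 ?negb_or ?cN0 //.
by move=> z _; rewrite rootZ.
Qed.

Lemma zeros_in_step (R : realType) (a b : nat -> R) (n : nat) (x y : R) :
    (forall k, (1 <= k)%N -> 0 < a k) ->
  (zeros_in (monic_orthopoly a b n.+1) x y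
     <= (zeros_in (monic_orthopoly a b n) x y).+1)%N
  /\ (zeros_in (monic_orthopoly a b n) x y
     <= (zeros_in (monic_orthopoly a b n.+1) x y).+1)%N.
Proof.
move=> a_gt0; rewrite !zeros_in_monic //; split.
  by apply: size_roots_interlace => z; exact: orthopoly_wronskian.
(* The Wronskian of (p_n, p_(n+1)) is negative: pass to - p_n. *)
have scaleN (P : {poly R}) : size (roots P x y) = size (roots (- P) x y).
  have [->|PN0] := eqVneq P 0; first by rewrite oppr0.
  congr size; apply/roots_eq; rewrite ?oppr_eq0 // => z _.
  by rewrite /root hornerN oppr_eq0.
rewrite scaleN; apply: size_roots_interlace => z.
rewrite derivN !hornerN.
have := orthopoly_wronskian _ _ b n z a_gt0; congr (0 < _); ring.
Qed.

Lemma zeros_in_lip (R : realType) (a b : nat -> R) (n k : nat) (x y : R) :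
    (forall k, (1 <= k)%N -> 0 < a k) ->
  (zeros_in (monic_orthopoly a b (n + k)) x y
     <= zeros_in (monic_orthopoly a b n) x y + k)%N
  /\ (zeros_in (monic_orthopoly a b n) x y
     <= zeros_in (monic_orthopoly a b (n + k)) x y + k)%N.
Proof.
move=> a_gt0; elim: k => [|k [IH1 IH2]]; first by rewrite !addn0.
have [] := zeros_in_step _ _ b (n + k) x y a_gt0.
rewrite -addnS; lia.
Qed.

(** * Critical points of a polynomial with real preimages *)

(** f'^2 - f f'' is f^2 times the sum of the 1 / (x - r)^2, for r ranging over
the roots of f.  In the induction, multiplying g by X - r
turns g'^2 - g g'' into g^2 + (x - r)^2 (g'^2 - g g''). *)
Lemma laguerre_strict (R : realDomainType) (c : R) (s : seq R) (x : R) :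
    let f := c *: \prod_(r <- s) ('X - r%:P) in
    s != [::] -> f.[x] != 0 ->
  f.[x] * f^`()^`().[x] < f^`().[x] ^+ 2.
Proof.
suff H : s != [::] -> let g := \prod_(r <- s) ('X - r%:P) in g.[x] != 0 ->
    g.[x] * g^`()^`().[x] < g^`().[x] ^+ 2.
  move=> f sN0; rewrite /f !derivZ !hornerZ mulf_eq0 negb_or => /andP[cN0 gN0].
  rewrite mulrACA -expr2 exprMn ltr_pM2l ?exprn_even_gt0 //; exact: H.
elim: s => [//|r s IHs] _; rewrite big_cons.
move: IHs; set g := \prod_(_ <- s) _ => IHs /=.
rewrite hornerM mulf_eq0 negb_or => /andP[_ gN0].
have IH : g.[x] * g^`()^`().[x] <= g^`().[x] ^+ 2.
  have [s0|sN0] := eqVneq s [::]; last exact/ltW/IHs.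
  by rewrite /g s0 big_nil !derivC !horner0 mulr0 sqr_ge0.
clearbody g; rewrite -subr_gt0 !derivM !derivXsubC mul1r derivD.
rewrite derivM derivXsubC mul1r !hornerE /=.
move: (g^`()^`().[x]) (g^`().[x]) (g.[x]) gN0 IH => g2 g1 g0 gN0 IH.
have : 0 < g0 ^+ 2 + (x - r) ^+ 2 * (g1 ^+ 2 - g0 * g2).
  by rewrite ltr_pwDl ?exprn_even_gt0 // mulr_ge0 ?sqr_ge0 // subr_ge0.
congr (0 < _); ring.
Qed.

Lemma real_rooted_split (R : rcfType) (f : {poly R}) :
    (forall z : R[i], root (map_poly (real_complex R) f) z ->
      exists x, z = real_complex R x) ->
  exists s : seq R, f = lead_coef f *: \prod_(r <- s) ('X - r%:P).
Proof.
have [->|fN0] := eqVneq f 0.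
  by move=> _; exists [::]; rewrite lead_coef0 scale0r.
move=> real_f.
have [s sE] := closed_field_poly_normal (map_poly (real_complex R) f).
have lN0 : lead_coef (map_poly (real_complex R) f) != 0.
  by rewrite lead_coef_eq0 map_poly_eq0.
have [t tE] : exists t : seq R, s = map (real_complex R) t.
  have : {in s, forall z, exists x, z = real_complex R x}.
    move=> z zs; apply: real_f; rewrite sE rootZ //.
    by rewrite root_prod_XsubC.
  elim: {sE} s => [|z s IHs] real_s; first by exists [::].
  have [|t ->] := IHs; first by move=> w ws; apply: real_s; rewrite inE ws orbT.
  have [|x ->] := real_s z; first by rewrite mem_head.
  by exists (x :: t).
exists t; apply: (map_inj_poly (@complexI R)); first exact: rmorph0.
rewrite {1}sE tE map_polyZ lead_coef_map; congr (_ *: _).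
rewrite rmorph_prod big_map; apply: eq_bigr => x _ /=.
by rewrite map_polyXsubC.
Qed.

(** If f' vanished at x, Laguerre's inequality for the real-rooted polynomial
f - t would read (f(x) - t) f''(x) < 0, for t on either side of f(x). *)
Lemma deriv_neq0_real_values (R : rcfType) (f : {poly R}) (u v : R) :
    (1 < size f)%N ->
    (forall z : R[i],
       real_complex R u < (map_poly (real_complex R) f).[z] < real_complex R v ->
       exists x, z = real_complex R x) ->
  forall x, u < f.[x] < v -> f^`().[x] != 0.
Proof.
move=> szf real_f x /andP[ux xv].
have lag t : u < t < v -> f.[x] != t ->
    (f.[x] - t) * f^`()^`().[x] < f^`().[x] ^+ 2.
  move=> /andP[ut tv] xNt.
  have [z|s sE] := real_rooted_split _ (f - t%:P).
    rewrite /root rmorphB /= map_polyC hornerD hornerN hornerC subr_eq0.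
    move=> /eqP zt.
    by apply: real_f; rewrite zt !ltcR ut.
  have sN0 : s != [::].
    apply: contraTneq szf => s0; move: sE; rewrite s0 big_nil alg_polyC.
    move=> /eqP; rewrite subr_eq -polyCD => /eqP ->.
    by rewrite -leqNgt size_polyC_leq1.
  have := laguerre_strict _ (lead_coef (f - t%:P)) s x sN0.
  rewrite -sE !(derivB, derivC) !subr0 hornerD hornerN hornerC.
  by apply; rewrite subr_eq0.
apply/eqP => f'0.
(* One value t on each side of f(x), still inside ]u, v[. *)
have := lag ((u + f.[x]) / 2); have := lag ((v + f.[x]) / 2).
rewrite f'0 expr0n /=; move: (f.[x]) (f^`()^`().[x]) ux xv => y d uy yv H1 H2.
have {}H1 : (y - (v + y) / 2) * d < 0.
  by apply: H1; [apply/andP; split; lra | apply/eqP; lra].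
have {}H2 : (y - (u + y) / 2) * d < 0.
  by apply: H2; [apply/andP; split; lra | apply/eqP; lra].
by nra.
Qed.

(** * Chebyshev polynomials of the second kind *)

(** Chebyshev's U_(n-1)(X / 2): the index is shifted so that the size is n and
the recurrence starts from 0, 1. *)
Fixpoint cheb (R : nzRingType) (n : nat) : {poly R} :=
  match n with
  | 0%N => 0
  | k.+1 => if k is l.+1 then 'X * cheb R k - cheb R l else 1
  end.

Lemma chebSS (R : nzRingType) (n : nat) :
  cheb R n.+2 = 'X * cheb R n.+1 - cheb R n.
Proof. by []. Qed.

Lemma size_cheb (R : nzRingType) (n : nat) : size (cheb R n) = n.
Proof.
suff [] : size (cheb R n) = n /\ size (cheb R n.+1) = n.+1 by [].
elim: n => [|n [IH0 IH1]]; first by rewrite size_poly0 size_poly1.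
have cN0 : cheb R n.+1 != 0 by rewrite -size_poly_gt0 IH1.
split; rewrite // chebSS -commr_polyX size_polyDl size_mulX ?IH1 //.
by rewrite size_polyN IH0 ltnS.
Qed.

Lemma cheb_trig (R : realType) (n : nat) (t : R) :
  (cheb R n).[2 * cos t] * sin t = sin (n%:R * t).
Proof.
suff [] : (cheb R n).[2 * cos t] * sin t = sin (n%:R * t) /\
    (cheb R n.+1).[2 * cos t] * sin t = sin (n.+1%:R * t) by [].
elim: n => [|n [IH0 IH1]]; first by rewrite horner0 hornerC !mul0r !mul1r sin0.
split=> //; rewrite chebSS hornerD hornerN hornerM hornerX mulrBl -mulrA IH0 IH1.
have -> : n.+2%:R * t = n.+1%:R * t + t.
  by rewrite -[n.+2]addn1 natrD mulrDl mul1r.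
have -> : n%:R * t = n.+1%:R * t - t.
  by rewrite -[n.+1]addn1 natrD mulrDl mul1r addrK.
by rewrite sinB sinD; ring.
Qed.

Lemma sin_natpi (R : realType) (n : nat) : sin (n%:R * pi : R) = 0.
Proof.
elim: n => [|n IHn]; first by rewrite mul0r sin0.
by rewrite -addn1 natrD mulrDl mul1r sinDpi IHn oppr0.
Qed.

(** The numbers 2 cos(k pi / (n+1)) for 0 < k <= n. *)
Lemma cheb_roots (R : realType) (n : nat) :
  exists s : seq R, [/\ uniq s, size s = n
    & {in s, forall t, root (cheb R n.+1) t /\ -2 < t < 2}].
Proof.
pose th k : R := k.+1%:R * (pi / n.+1%:R).
have pin_gt0 : 0 < pi / n.+1%:R :> R by rewrite divr_gt0 ?pi_gt0 ?ltr0n.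
have th_itv k : (k < n)%N -> 0 < th k < pi.
  move=> kn; rewrite mulr_gt0 ?ltr0n //= /th mulrCA -[ltRHS]mulr1.
  by rewrite ltr_pM2l ?pi_gt0 // ltr_pdivrMr ?ltr0n // mul1r ltr_nat ltnS.
exists [seq 2 * cos (th k) | k <- iota 0 n]; split.
- rewrite map_inj_in_uniq ?iota_uniq // => k l.
  rewrite !mem_iota !add0n /= => /th_itv/andP[k0 k1] /th_itv/andP[l0 l1].
  move=> /(mulfI _)/cos_inj; rewrite !in_itv /= !ltW // pnatr_eq0 => H.
  have /(mulIf _)/eqP := H isT isT isT.
  by rewrite gt_eqF // eqr_nat eqSS => /(_ isT)/eqP.
- by rewrite size_map size_iota.
move=> t /mapP[k kn ->{t}].
have thk : 0 < th k < pi by apply: th_itv; rewrite mem_iota add0n in kn.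
have sin_gt0 := sin_gt0_pi thk; split.
  have kpi : n.+1%:R * th k = k.+1%:R * pi.
    by rewrite /th mulrCA [X in _ * X]mulrC divfK ?pnatr_eq0.
  have /eqP := cheb_trig R n.+1 (th k).
  by rewrite kpi sin_natpi mulf_eq0 (gt_eqF sin_gt0) orbF.
have := cos2Dsin2 (th k); nra.
Qed.

(** * The transfer matrix over one period *)

Section Transfer.
Variables (R : realType) (p : nat) (a b : nat -> R).
Hypotheses (p_gt0 : (1 <= p)%N) (hab : periodic_jacobi p a b).

Let T := transfer_matrix p a b.

Lemma transfer_matrixS_row1 (n : nat) (j : 'I_2) : T n.+1 1 j = T n 0 j.
Proof.
have [a_gt0 _ _] := hab.
rewrite /T /= mxE big_ord_recl big_ord1 !mxE /= mulr0 mul0r addr0.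
by rewrite -polyCM mulVf ?mul1r // gt_eqF ?a_gt0.
Qed.

Lemma transfer_matrixS_row0 (n : nat) (j : 'I_2) :
  T n.+1 0 j = (a n.+1)^-1 *:
    (('X - (b n.+1)%:P) * T n 0 j - acoef p a n *: T n 1 j).
Proof.
rewrite /T /= mxE big_ord_recl big_ord1 !mxE /= -!mul_polyC.
have -> : lift ord0 ord0 = 1 :> 'I_2 by exact: val_inj.
ring.
Qed.

Lemma transfer_matrix_col0 (n : nat) :
  T n 0 0 = orthopoly a b n /\ T n.+1 1 0 = orthopoly a b n.
Proof.
rewrite transfer_matrixS_row1.
suff [] : T n 0 0 = orthopoly a b n /\ T n.+1 0 0 = orthopoly a b n.+1 by [].
elim: n => [|n [IH0 IH1]].
  by rewrite transfer_matrixS_row0 /T /= !mxE /= scaler0.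
by split=> //; rewrite transfer_matrixS_row0 transfer_matrixS_row1 IH0 IH1.
Qed.

Lemma transfer_matrixD (n : nat) : T (n + p)%N = T n *m T p.
Proof.
have [_ aD bD] := hab.
elim: n => [|n IHn]; first by rewrite mul1mx.
rewrite addSn /T /= -/(T (n + p)%N) IHn mulmxA; congr (_ *m _ *m _).
have aS : a (n + p)%N.+1 = a n.+1 by rewrite -addSn aD.
have bS : b (n + p)%N.+1 = b n.+1 by rewrite -addSn bD.
have cS : acoef p a (n + p)%N = acoef p a n.
  case: n {IHn aS bS} => [|n]; rewrite /acoef; first by rewrite add0n gtn_eqF.
  by rewrite addSn /= -addSn aD.
by rewrite /step_matrix aS bS cS.
Qed.

(** The one-step determinants a_k / a_(k+1) telescope to a_0 / a_n, which is 1
at n = p since a_0 stands for a_p. *)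
Lemma transfer_matrix_det : T p 0 0 * T p 1 1 - T p 0 1 * T p 1 0 = 1.
Proof.
have [a_gt0 _ _] := hab.
suff H n :
    (acoef p a n)%:P * (T n 0 0 * T n 1 1 - T n 0 1 * T n 1 0) = (a p)%:P.
  have ap : (a p)%:P != 0 :> {poly R} by rewrite polyC_eq0 gt_eqF ?a_gt0.
  by apply: (mulfI ap); rewrite mulr1 -[RHS](H p) /acoef gtn_eqF.
elim: n => [|n IHn]; first by rewrite /T /= !mxE /= mulr0 subr0 !mulr1.
rewrite !transfer_matrixS_row0 !transfer_matrixS_row1 -[RHS]IHn -!mul_polyC.
have : (a n.+1)%:P * (a n.+1)^-1%:P = 1 :> {poly R}.
  by rewrite -polyCM divff ?gt_eqF ?a_gt0.
rewrite /acoef /=.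
move: (T n 0 0) (T n 0 1) (T n 1 0) (T n 1 1) => t00 t01 t10 t11 aV.
transitivity ((a n.+1)%:P * (a n.+1)^-1%:P *
  ((acoef p a n)%:P * (t00 * t11 - t01 * t10))).
  rewrite /acoef; ring.
by rewrite aV mul1r.
Qed.

Lemma discriminantE : discriminant p a b = T p 0 0 + T p 1 1.
Proof.
rewrite /discriminant /mxtrace big_ord_recl big_ord1 -/T.
by congr (_ + T p _ _); exact: val_inj.
Qed.

(** Cayley-Hamilton for a 2 x 2 matrix of determinant 1. *)
Lemma transfer_matrix_sqr (i j : 'I_2) :
  (T p *m T p) i j = discriminant p a b * T p i j - (i == j)%:R.
Proof.
have lift1 : lift ord0 ord0 = 1 :> 'I_2 by exact: val_inj.
have ord2 (k : 'I_2) : k = 0 \/ k = 1.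
  by case: k => [[|[|//]] kP]; [left | right]; exact: val_inj.
rewrite mxE big_ord_recl big_ord1 lift1 discriminantE.
rewrite -transfer_matrix_det.
by case: (ord2 i) => ->; case: (ord2 j) => -> /=; ring.
Qed.

(** By Cayley-Hamilton the lower left entries of the powers of T(p), which are
the polynomials on the left, satisfy the recurrence of [cheb] with X replaced by
the discriminant; they start from 0 and p_(p-1). *)
Lemma orthopoly_period (m : nat) :
  orthopoly a b (m.+1 * p)%N.-1
    = orthopoly a b p.-1 * (cheb R m.+1 \Po discriminant p a b).
Proof.
have col n : (0 < n)%N -> T n 1 0 = orthopoly a b n.-1.
  by case: n => // n _; have [] := transfer_matrix_col0 n.
rewrite -!col ?muln_gt0 //.
suff [] : T (m * p)%N 1 0 = T p 1 0 * (cheb R m \Po discriminant p a b) /\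
    T (m.+1 * p)%N 1 0 = T p 1 0 * (cheb R m.+1 \Po discriminant p a b) by [].
elim: m => [|m [IH0 IH1]].
  rewrite mul0n mul1n /= comp_poly0 comp_polyC mulr1 mulr0.
  by rewrite /T /= mxE.
split=> //; rewrite chebSS comp_polyB comp_polyM comp_polyX mulrBr.
rewrite mulrCA -IH0 -IH1 !mulSnr !transfer_matrixD -mulmxA.
rewrite 2!mxE !big_ord_recl !big_ord0 !transfer_matrix_sqr /=.
have -> : lift ord0 ord0 = 1 :> 'I_2 by exact: val_inj.
rewrite /=; ring.
Qed.

(** There T(p) is triangular of determinant 1, so its trace has the form
A + 1 / A. *)
Lemma discriminant_orthopoly_root (x : R) :
  root (orthopoly a b p.-1) x -> ~~ (-2 < (discriminant p a b).[x] < 2).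
Proof.
have -> : orthopoly a b p.-1 = T p 1 0.
  by case: p p_gt0 T transfer_matrix_col0 => // n _ T' /(_ n)[].
move=> /rootP x0; have := congr1 (horner^~ x) transfer_matrix_det.
rewrite /= discriminantE !hornerD hornerN !hornerM x0 mulr0 subr0 hornerC.
move: (T p 0 0).[x] (T p 1 1).[x] => A D AD; apply/negP => /andP[lt1 lt2].
have : 0 < (A + D + 2) * (2 - (A + D)) by apply: mulr_gt0; lra.
have := sqr_ge0 (A - D); nra.
Qed.

End Transfer.

(** * Polynomials that map an interval bijectively *)
Lemma deriv_neq0_inj (R : rcfType) (f : {poly R}) (x y : R) :
    {in `]x, y[, forall z, f^`().[z] != 0} ->
  {in `]x, y[ &, injective (horner f)}.
Proof.
move=> f'N0.
suff H u v : u \in `]x, y[ -> v \in `]x, y[ -> f.[u] = f.[v] -> ~ u < v.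
  move=> u v uxy vxy fuv; have := H u v uxy vxy fuv.
  have := H v u vxy uxy (esym fuv).
  by case: (ltgtP u v).
rewrite !in_itv /= => /andP[xu uy] /andP[xv vy] fuv uv.
have [w] := poly_rolle uv fuv; rewrite in_itv /= => /andP[uw wv] /eqP.
by apply/negP; rewrite f'N0 // in_itv /= (lt_trans xu uw) (lt_trans wv vy).
Qed.

Lemma poly_ivt_value (R : rcfType) (f : {poly R}) (x y t : R) :
  x <= y -> (f.[x] - t) * (f.[y] - t) < 0 -> exists2 z, x < z < y & f.[z] = t.
Proof.
move=> xy ft; have [|z] := @poly_ivtoo _ (f - t%:P) x y xy.
  by rewrite !hornerE.
rewrite in_itv => zxy /rootP; rewrite !hornerE => /eqP.
by rewrite subr_eq0 => /eqP; exists z.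
Qed.

(** The ends take values outside ]u, v[; they cannot lie on the same side of it,
since f, being injective, cannot come back to a value it has left. *)
Lemma band_surj (R : rcfType) (f : {poly R}) (x y u v : R) :
    x < y -> u < v ->
    {in `]x, y[, forall z, u < f.[z] < v} ->
    ~~ (u < f.[x] < v) -> ~~ (u < f.[y] < v) ->
    {in `]x, y[ &, injective (horner f)} ->
  forall t, u < t < v -> exists2 z, z \in `]x, y[ & f.[z] = t.
Proof.
move=> xy uv f_itv fx fy f_inj t /andP[ut tv].
pose m := (x + y) / 2.
have xm : x < m by rewrite /m; lra.
have my : m < y by rewrite /m; lra.
have /f_itv/andP[um mv] : m \in `]x, y[ by rewrite in_itv /= xm my.
(* If the ends lie on one side of a value s and the midpoint on the other,
   then f takes the value s on both sides of m. *)
have same_side s : 0 < (f.[x] - s) * (f.[y] - s) ->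
    (f.[x] - s) * (f.[m] - s) < 0 -> False.
  move=> sxy sxm.
  have [z1 /andP[xz1 z1m] fz1] := poly_ivt_value _ _ _ _ _ (ltW xm) sxm.
  have [|z2 /andP[mz2 z2y] fz2] := poly_ivt_value _ f m y s (ltW my).
    have : (f.[x] - s) * (f.[y] - s) * ((f.[x] - s) * (f.[m] - s)) < 0.
      by rewrite pmulr_rlt0.
    rewrite mulrACA [_ * (f.[m] - s)]mulrC !ltNge; apply: contra.
    by apply: mulr_ge0; rewrite -expr2 sqr_ge0.
  have /f_inj : z1 \in `]x, y[ by rewrite in_itv /= xz1 (lt_trans z1m).
  move=> /(_ z2); rewrite in_itv /= z2y (lt_trans xm) // fz1 fz2.
  by move=> /(_ isT erefl) z12; move: (lt_trans z1m mz2); rewrite z12 ltxx.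
have [|z zxy <-] := poly_ivt_value _ f x y t (ltW xy); last first.
  by exists z; rewrite // in_itv.
have {}fx : f.[x] <= u \/ v <= f.[x].
  by move: fx; rewrite negb_and -!leNgt => /orP.
have {}fy : f.[y] <= u \/ v <= f.[y].
  by move: fy; rewrite negb_and -!leNgt => /orP.
have := same_side ((u + f.[m]) / 2); have := same_side ((v + f.[m]) / 2).
move: (f.[x]) (f.[y]) (f.[m]) fx fy um mv => X Y M [] HX [] HY um mv Hv Hu.
- by case: Hu; nra.
- by nra.
- by nra.
- by case: Hv; nra.
Qed.

(** f pairs the roots in ]x, y[ with the m roots of [cheb R m.+1]: its injectivity
bounds the count from above by the degree, its surjectivity onto ]-2, 2[ from
below. *)
Lemma size_roots_cheb_comp (R : realType) (f q : {poly R}) (x y : R) (m : nat) :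
    q != 0 -> {in `]x, y[, forall z, ~~ root q z} ->
    {in `]x, y[ &, injective (horner f)} ->
    (forall t, -2 < t < 2 -> exists2 z, z \in `]x, y[ & f.[z] = t) ->
    q * (cheb R m.+1 \Po f) != 0 ->
  size (roots (q * (cheb R m.+1 \Po f)) x y) = m.
Proof.
move=> qN0 q_root f_inj f_surj PN0.
have rootsE z : (z \in roots (q * (cheb R m.+1 \Po f)) x y)
    = (z \in `]x, y[) && root (cheb R m.+1) f.[z].
  rewrite in_roots PN0 andbT andbC; case: (boolP (z \in _)) => //= /q_root.
  by rewrite rootM => /negPf ->; rewrite /root horner_comp.
apply/eqP; rewrite eqn_leq; apply/andP; split.
  rewrite -ltnS -[ltnRHS](size_cheb R) -(size_map (horner f)).
  apply: max_poly_roots.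
  - by rewrite -size_poly_gt0 size_cheb.
  - by apply/allP => t /mapP[z + ->]; rewrite rootsE => /andP[].
  - rewrite map_inj_in_uniq ?uniq_roots // => z w.
    by rewrite !rootsE => /andP[zxy _] /andP[wxy _]; exact: f_inj.
have [s [s_uniq s_size s_root]] := cheb_roots R m.
have [s' sE s'_itv] : exists2 s', s = map (horner f) s' & {subset s' <= `]x, y[}.
  elim: s s_root {s_uniq s_size} => [|t s IHs] s_root; first by exists [::].
  have [|s' -> s'P] := IHs.
    by move=> w ws; apply: s_root; rewrite inE ws orbT.
  have [|_ /f_surj[z zxy <-]] := s_root t; first by rewrite mem_head.
  exists (z :: s') => // w; rewrite inE => /orP[/eqP ->//|]; exact: s'P.
rewrite -[leqLHS]s_size sE size_map; apply: uniq_leq_size.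
  by apply: (@map_uniq _ _ (horner f)); rewrite -sE.
move=> z zs'; rewrite rootsE s'_itv //=.
by have [] := s_root f.[z]; rewrite // sE map_f.
Qed.

(** * Counting zeros in a band *)

Section Band.
Variables (R : realType) (p : nat) (a b : nat -> R) (alpha beta : 'I_p -> R).
Hypothesis hband : band_edges a b alpha beta.
Let Delta := discriminant p a b.

Lemma discriminant_realE (x : R) :
  (-2 < discriminant_at p a b (real_complex R x) < 2) = (-2 < Delta.[x] < 2).
Proof.
rewrite /discriminant_at horner_map /= -/Delta.
have -> : 2 = real_complex R 2 by rewrite rmorph_nat.
by rewrite -rmorphN !ltcR.
Qed.

Lemma bandP (x : R) : -2 < Delta.[x] < 2 <-> exists i, alpha i < x < beta i.
Proof.
have [_ _ bands] := hband; rewrite -discriminant_realE bands; split.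
  by move=> [i [y [iy /complexI ->]]]; exists i.
by move=> [i xi]; exists i, x.
Qed.

(** The bands are open and ordered, so no band contains an edge. *)
Lemma discriminant_edges (j : 'I_p) :
  ~~ (-2 < Delta.[alpha j] < 2) /\ ~~ (-2 < Delta.[beta j] < 2).
Proof.
have [ab ba _] := hband; have abj := ab j.
split; apply/negP => /bandP[i /andP[]]; have abi := ab i.
  case: (ltngtP i j) => [/ba|/ba|/val_inj ->]; lra.
case: (ltngtP i j) => [/ba|/ba|/val_inj ->]; lra.
Qed.

Lemma discriminant_real_rooted (z : R[i]) :
    real_complex R (-2) < (map_poly (real_complex R) Delta).[z]
      < real_complex R 2 ->
  exists x, z = real_complex R x.
Proof.
have [_ _ bands] := hband; rewrite rmorphN !rmorph_nat => /bands[j [x [_ ->]]].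
by exists x.
Qed.

(** A constant discriminant would take its band value at i, which is not real. *)
Lemma size_discriminant (j : 'I_p) : (1 < size Delta)%N.
Proof.
have [ab _ _] := hband; rewrite ltnNge; apply/negP => /size1_polyC DC.
have /bandP : exists i, alpha i < (alpha j + beta j) / 2 < beta i.
  by exists j; have := ab j; move=> ?; apply/andP; split; lra.
rewrite DC hornerC => c_itv.
have [|x /eqP] := discriminant_real_rooted 'i%C.
  by rewrite DC map_polyC hornerC !ltcR.
by rewrite eq_complex /= oner_eq0 andbF.
Qed.

Lemma discriminant_inj (j : 'I_p) :
  {in `]alpha j, beta j[ &, injective (horner Delta)}.
Proof.
apply: deriv_neq0_inj => z zj.
apply: deriv_neq0_real_values (size_discriminant j) discriminant_real_rooted _ _.
by apply/bandP; exists j; rewrite in_itv in zj.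
Qed.

Lemma discriminant_surj (j : 'I_p) (t : R) :
  -2 < t < 2 -> exists2 z, z \in `]alpha j, beta j[ & Delta.[z] = t.
Proof.
have [ab _ _] := hband; have [Da Db] := discriminant_edges j.
apply: band_surj Da Db (@discriminant_inj j) t => //; first lra.
by move=> z; rewrite in_itv => zj; apply/bandP; exists j.
Qed.

Lemma zeros_in_band_period (hab : periodic_jacobi p a b) (m : nat) (j : 'I_p) :
  zeros_in (monic_orthopoly a b (m.+1 * p)%N.-1) (alpha j) (beta j) = m.
Proof.
have [a_gt0 _ _] := hab.
have p_gt0 : (1 <= p)%N by apply: leq_ltn_trans (ltn_ord j).
rewrite zeros_in_monic // orthopoly_period //; apply: size_roots_cheb_comp.
- exact: orthopoly_neq0.
- move=> z zj; apply/negP => /(discriminant_orthopoly_root _ _ _ _ p_gt0 hab).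
  by apply/negP; rewrite negbK; apply/bandP; exists j; rewrite in_itv in zj.
- exact: discriminant_inj.
- exact: discriminant_surj.
- by rewrite -orthopoly_period //; exact: orthopoly_neq0.
Qed.

(** The first two bounds come from the degree mp - 1 (or from p_0 = 1 when
m = 0), the last two from the degree (m+1)p - 1. *)
Lemma zeros_in_band_bounds (hab : periodic_jacobi p a b) (m c : nat) (j : 'I_p) :
    (c < p)%N ->
  let N := zeros_in (monic_orthopoly a b (m * p + c)%N) (alpha j) (beta j) in
  [/\ (m <= N + c.+2)%N, (N <= m + c)%N
    & (m <= N + (p - c.+1))%N /\ (N <= m + (p - c.+1))%N].
Proof.
move=> lt_cp N; have [a_gt0 _ _] := hab.
have p_gt0 : (0 < p)%N by apply: leq_ltn_trans lt_cp.
have [up1 up2] : (m <= N + (p - c.+1))%N /\ (N <= m + (p - c.+1))%N.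
  have := zeros_in_lip R a b (m * p + c) (p - c.+1) (alpha j) (beta j) a_gt0.
  rewrite (_ : (_ + (p - c.+1)) = (m.+1 * p).-1)%N; last by rewrite mulSn; lia.
  rewrite zeros_in_band_period // -/N; lia.
suff [lo1 lo2] : (m <= N + c.+2)%N /\ (N <= m + c)%N by split.
case: m @N {up1 up2} => [|m] N.
  have := zeros_in_lip R a b 0 c (alpha j) (beta j) a_gt0.
  have -> : zeros_in (monic_orthopoly a b 0) (alpha j) (beta j) = 0%N.
    by rewrite zeros_in_monic //= rootsC.
  by rewrite /N mul0n; lia.
have := zeros_in_lip R a b (m.+1 * p).-1 c.+1 (alpha j) (beta j) a_gt0.
rewrite (_ : (_ + c.+1) = m.+1 * p + c)%N; last by rewrite mulSn; lia.
rewrite zeros_in_band_period // -/N; lia.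
Qed.

End Band.

Theorem theorem2p3 (R : realType) (p : nat) (hp : (1 <= p)%N)
    (a b : nat -> R) (hab : periodic_jacobi p a b)
    (alpha beta : 'I_p -> R) (hband : band_edges a b alpha beta) (j : 'I_p) :
  (forall (m : nat) (c : int) (n : nat),
      -1 <= c <= p%:Z - 1 -> n%:Z = m%:Z * p%:Z + c ->
      `|(zeros_in (monic_orthopoly a b n) (alpha j) (beta j))%:Z - (m%:Z - 1)|
        <= Num.min (c + 1) (p%:Z - c))
  /\
  (forall n : nat,
      `|(zeros_in (monic_orthopoly a b n) (alpha j) (beta j))%:R - n%:R / p%:R|
        <= 1 + p%:R / 2 :> R).
Proof.
have bounds := zeros_in_band_bounds R p a b alpha beta hband hab.
split=> [m c n c_itv nE|n].
  case: c c_itv nE => [c|c] c_itv nE; last first.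
    (* Negz c is - c.+1, so c is 0 and the integer is -1. *)
    have [-> mp] : c = 0%N /\ n.+1 = (m * p)%N by lia.
    case: m mp {nE} => [|m] mp; first by lia.
    have -> : n = (m.+1 * p).-1%N by rewrite -mp.
    rewrite (zeros_in_band_period R p a b alpha beta hband hab).
    by rewrite le_min; lia.
  have -> : n = (m * p + c)%N by lia.
  have lt_cp : (c < p)%N by lia.
  have [lo hi [lo' hi']] := bounds m c j lt_cp.
  by rewrite le_min; apply/andP; split; lia.
set m := (n %/ p)%N; set c := (n %% p)%N.
have lt_cp : (c < p)%N by rewrite ltn_mod.
have nE : n = (m * p + c)%N by exact: divn_eq.
have [lo hi [lo' hi']] := bounds m c j lt_cp.
rewrite nE; move: (zeros_in _ _ _) lo hi lo' hi' => N lo hi lo' hi'.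
have p_gt0 : 0 < p%:R :> R by rewrite ltr0n.
have -> : (m * p + c)%N%:R / p%:R = m%:R + c%:R / p%:R :> R.
  by rewrite natrD natrM mulrDl mulfK // gt_eqF.
pose e : R := c%:R / p%:R.
have e_ge0 : 0 <= e by rewrite divr_ge0 ?ler0n.
have ecp : e * p%:R = c%:R by rewrite /e divfK // gt_eqF.
move: lo hi lo' hi'; rewrite -!(ler_nat R) -[c.+2]addn2 !natrD natrB //.
rewrite -[c.+1]addn1 natrD -/e.
have p_ge1 : 1 <= p%:R :> R by rewrite ler1n.
move: (N%:R : R) (m%:R : R) (c%:R : R) (p%:R : R) e e_ge0 ecp p_gt0 p_ge1.
move=> N' m' c' p' e e_ge0 ecp p_gt0 p_ge1 lo hi lo' hi'.
rewrite ler_norml; apply/andP; split; last by lra.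
(* Average the two lower bounds for N - m with weights proportional to p - 1 and
   p + 1: the resulting term in c cancels against e = c / p. *)
have lo1 : 0 <= (N' + (c' + 2) - m') * (p' - 1) by apply: mulr_ge0; lra.
have lo2 : 0 <= (N' + (p' - (c' + 1)) - m') * (p' + 1) by apply: mulr_ge0; lra.
rewrite -subr_ge0 -(pmulr_rge0 _ p_gt0); nra.
Qed.
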